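(* A timelike loxodrome on a timelike helicoidal surface of type III in $\mathbb{E}^n_1$, the surface being parametrized by $$H_3(u,v)=x_1(u)e_1+\sqrt2\,v\,x_n(u)e_2+x_3(u)e_3+\cdots+x_{n-2}(u)e_{n-2}+(x_{n-1}(u)+v^2x_n(u)+cv)\xi_{n-1}+x_n(u)\xi_n,$$ is parametrized by $\alpha_3(u)=H_3(u,v(u))$, where $v(u)$ is given by one of the following functions: (i) $$v(u)=\int_{u_0}^u\frac{2c\cosh^2\phi_0\,x_n'(\xi)\pm\sqrt{\sinh^2(2\phi_0)\,(c^2x_n'^2(\xi)-2x_n^2(\xi))}}{4\sinh^2\phi_0\,x_n^2(\xi)+2c^2x_n'^2(\xi)}\,d\xi;$$ (ii) $$v(u)=\int_{u_0}^u\frac{2c\sinh^2\phi_0\,x_n'(\xi)\pm\sqrt{\sinh^2(2\phi_0)\,(2x_n^2(\xi)+c^2x_n'^2(\xi))}}{4\cosh^2\phi_0\,x_n^2(\xi)+2c^2x_n'^2(\xi)}\,d\xi,$$ where $\phi_0$ (the constant angle of the loxodrome with the meridians) is a positive constant.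
   Context: $\mathbb{E}^n_1$ is $\mathbb{R}^n$ with the metric $\langle\cdot,\cdot\rangle$ given by $dx_1^2+\cdots+dx_{n-1}^2-dx_n^2$, and $\|w\|=\sqrt{|\langle w,w\rangle|}$. A vector $w$ is spacelike if $\langle w,w\rangle>0$ or $w=0$, timelike if $\langle w,w\rangle<0$; a curve is spacelike or timelike if its velocity is. Let $\{e_1,\dots,e_n\}$ be the standard orthonormal basis and $\xi_{n-1}=\frac1{\sqrt2}(e_n-e_{n-1})$, $\xi_n=\frac1{\sqrt2}(e_n+e_{n-1})$, so that $\langle\xi_{n-1},\xi_{n-1}\rangle=\langle\xi_n,\xi_n\rangle=0$ and $\langle\xi_{n-1},\xi_n\rangle=-1$. (The integration variable $\xi$ is a real number, unrelated to these vectors.) Helicoidal surface of type III: let $\beta(u)=x_1(u)e_1+x_3(u)e_3+\cdots+x_{n-2}(u)e_{n-2}+x_{n-1}(u)\xi_{n-1}+x_n(u)\xi_n$ be a smooth curve defined on an open interval $I\subset\mathbb{R}$ and parametrized by arc length, i.e. $x_1'^2+x_3'^2+\cdots+x_{n-2}'^2-2x_{n-1}'x_n'=\varepsilon$ with $\varepsilon=\pm1$, and let $c$ be a positive constant. The surface is parametrized by $H_3(u,v)$ as in the claim, with $u\in I$ and $v$ a real parameter. It is timelike if $EG-F^2<0$, where $E=\langle (H_3)_u,(H_3)_u\rangle$, $F=\langle (H_3)_u,(H_3)_v\rangle$, $G=\langle (H_3)_v,(H_3)_v\rangle$; that is, $2\varepsilon x_n^2(u)-c^2x_n'^2(u)<0$.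 The meridians are the curves $u\mapsto H_3(u,v_0)$ with $v_0$ constant; they are spacelike if $\varepsilon=1$ and timelike if $\varepsilon=-1$. Lorentzian timelike angle: for a spacelike vector $x$ and a timelike vector $y$, it is the unique nonnegative real number $\theta$ with $\langle x,y\rangle=\pm\|x\|\|y\|\sinh\theta$; for timelike vectors $x,y$, it is the unique nonnegative real number $\theta$ with $\langle x,y\rangle=\|x\|\|y\|\cosh\theta$. A timelike loxodrome on the surface is a timelike curve $\alpha_3(t)=H_3(u(t),v(t))$ that intersects the meridians at a constant angle $\phi_0$, i.e. the Lorentzian timelike angle between its velocity and the meridian tangent vector $(H_3)_u$ is $\phi_0$ at each point. The number $u_0$ is a fixed value of the parameter $u$.
   Formalization: The formal statement adds the integration constant, v(u) = v(u_0) + the printed integral, because the printed formula forces v(u_0) = 0 while adding a nonzero constant to v gives another timelike loxodrome with the same angle. *)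

(* Defs.v *)
From mathcomp Require Import all_boot all_order all_algebra.
From mathcomp Require Import all_classical all_reals all_analysis.
Import Order.TTheory GRing.Theory Num.Theory.
Import numFieldNormedType.Exports.

Set Implicit Arguments.
Unset Strict Implicit.
Unset Printing Implicit Defensive.

(* [derive1 f] is written out below: in [ring_scope], f^`() is the formal
   derivative of a polynomial. *)
Local Open Scope ring_scope.
Local Open Scope classical_set_scope.

Definition sinh {R : realType} (x : R) : R := (expR x - expR (- x)) / 2.
Definition cosh {R : realType} (x : R) : R := (expR x + expR (- x)) / 2.

(* The library's integral is over unoriented sets; this is the integral from
   [a] to [b], with the opposite sign when [b < a]. *)
Definition oriented_integral {R : realType} (a b : R) (f : R -> R) : R :=
  if a <= b then \int[lebesgue_measure]_(x in `[a, b]) f x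
  else - \int[lebesgue_measure]_(x in `[b, a]) f x.

Definition open_interval {R : realType} (I : set R) : Prop :=
  [/\ open I, is_interval I & I !=set0].

Definition smooth_on {R : realType} (I : set R) (f : R -> R) : Prop :=
  forall k t, I t -> derivable (derive1n k f) t 1.

Section Minkowski.
Context {R : realType} {n : nat}.
Implicit Types x y w : 'rV[R]_n.

(* Coordinates are numbered from 1 as in dx_1^2 + ... + dx_{n-1}^2 - dx_n^2,
   so the ordinal [i] stands for the coordinate [i.+1]. *)
Definition mink x y : R :=
  \sum_(i < n) (if i.+1 == n then - (x 0 i * y 0 i) else x 0 i * y 0 i).

Definition mnorm w : R := Num.sqrt `|mink w w|.

Definition spacelike w : Prop := 0 < mink w w \/ w = 0.
Definition timelike w : Prop := mink w w < 0.

Definition timelike_angle x y (theta : R) : Prop :=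
  0 <= theta /\
  ((((spacelike x /\ timelike y) \/ (timelike x /\ spacelike y)) /\
    (mink x y = mnorm x * mnorm y * sinh theta \/
     mink x y = - (mnorm x * mnorm y * sinh theta))) \/
   [/\ timelike x, timelike y & mink x y = mnorm x * mnorm y * cosh theta]).

End Minkowski.

Section Helicoidal.
Context {R : realType} (n : nat).

(* [e_ k] is the k-th standard basis vector, 1 <= k <= n. *)
Definition e_ (k : nat) : 'rV[R]_n := \row_(i < n) (i.+1 == k)%:R.

(* [xi_n1] is xi_{n-1}. *)
Definition xi_n1 : 'rV[R]_n := (Num.sqrt 2)^-1 *: (e_ n - e_ n.-1).
Definition xi_n : 'rV[R]_n := (Num.sqrt 2)^-1 *: (e_ n + e_ n.-1).

Variables (c : R) (x : nat -> R -> R).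

(* The component functions are [x 1], [x 3], ..., [x n]; the curve has no
   component [x 2]. *)
Definition profile (u : R) : 'rV[R]_n :=
  x 1 u *: e_ 1 + \sum_(3 <= k < n.-1) x k u *: e_ k
  + x n.-1 u *: xi_n1 + x n u *: xi_n.

Definition H3 (u v : R) : 'rV[R]_n :=
  x 1 u *: e_ 1 + (Num.sqrt 2 * v * x n u) *: e_ 2
  + \sum_(3 <= k < n.-1) x k u *: e_ k
  + (x n.-1 u + v ^+ 2 * x n u + c * v) *: xi_n1 + x n u *: xi_n.

Definition H3_u (u v : R) : 'rV[R]_n := derive1 (fun s => H3 s v) u.
Definition H3_v (u v : R) : 'rV[R]_n := derive1 (fun s => H3 u s) v.

Definition smooth_profile (I : set R) : Prop :=
  forall k, (1 <= k <= n)%N -> k != 2 -> smooth_on I (x k).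

Definition arc_length_profile (I : set R) (eps : R) : Prop :=
  forall u, I u -> mink (derive1 profile u) (derive1 profile u) = eps.

Definition timelike_surface (I : set R) : Prop :=
  forall u v, I u ->
    let E := mink (H3_u u v) (H3_u u v) in
    let F := mink (H3_u u v) (H3_v u v) in
    let G := mink (H3_v u v) (H3_v u v) in
    E * G - F ^+ 2 < 0.

(* The curve t |-> H3 (u t) (v t), t in J, is a timelike loxodrome making the
   constant angle [phi0] with the meridians; it need not be parametrized
   by [u]. *)
Definition timelike_loxodrome (I J : set R) (u v : R -> R) (phi0 : R) : Prop :=
  let alpha t := H3 (u t) (v t) in
  [/\ smooth_on J u, smooth_on J v, forall t, J t -> I (u t),
      forall t, J t -> timelike (derive1 alpha t) &
      forall t, J t ->
        timelike_angle (H3_u (u t) (v t)) (derive1 alpha t) phi0].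

(* [u] is an admissible change of parameter turning [alpha] into [gamma]. *)
Definition reparametrized_by (J : set R) (u : R -> R)
    (alpha gamma : R -> 'rV[R]_n) : Prop :=
  [/\ forall t, J t -> derive1 u t != 0,
      forall s t, J s -> J t -> u s = u t -> s = t &
      forall t, J t -> alpha t = gamma (u t)].

End Helicoidal.

(* The integrands giving v'(u); [s] selects the sign in front of the root:
   + for [false], - for [true]. *)
Definition slope_i {R : realType} (c phi0 : R) (xn : R -> R) (s : bool)
    (z : R) : R :=
  (2 * c * cosh phi0 ^+ 2 * derive1 xn z +
     (-1) ^+ s * Num.sqrt (sinh (2 * phi0) ^+ 2 *
       (c ^+ 2 * derive1 xn z ^+ 2 - 2 * xn z ^+ 2))) /
  (4 * sinh phi0 ^+ 2 * xn z ^+ 2 + 2 * c ^+ 2 * derive1 xn z ^+ 2).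

Definition slope_ii {R : realType} (c phi0 : R) (xn : R -> R) (s : bool)
    (z : R) : R :=
  (2 * c * sinh phi0 ^+ 2 * derive1 xn z +
     (-1) ^+ s * Num.sqrt (sinh (2 * phi0) ^+ 2 *
       (2 * xn z ^+ 2 + c ^+ 2 * derive1 xn z ^+ 2))) /
  (4 * cosh phi0 ^+ 2 * xn z ^+ 2 + 2 * c ^+ 2 * derive1 xn z ^+ 2).

(* Main.v *)
(* In the frame (e_1, ..., e_(n-2), xi_(n-1), xi_n) the velocity of
   H3 (u t) (v t) has the Minkowski form
     eps U^2 - 2 c xn' U V + 2 xn^2 V^2,   U = u', V = v',
   and its product with the meridian tangent is eps U - c xn' V. Squaring the
   angle condition and completing the square gives
     (A V - B U)^2 = D U^2
   with A, B, D functions of the point u of the profile: the integrands of the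
   statement are (B +- sqrt D) / A. The timelike character of the surface makes
   A and D positive, so U never vanishes, u is an admissible parameter, and by
   connectedness one sign is taken along the whole curve; then v is recovered
   from dv/du by integration. *)

Require Import Defs.
From mathcomp Require Import all_boot all_order all_algebra ring lra.
From mathcomp Require Import all_classical all_reals all_analysis.
Import Order.TTheory GRing.Theory Num.Theory.
Import numFieldNormedType.Exports.
Local Open Scope ring_scope.
Local Open Scope classical_set_scope.

Set Implicit Arguments.
Unset Strict Implicit.

(** * Coordinates in the frame with two null vectors, and the Minkowski form there *)

Section Frame.
Variables (R : realType) (n : nat).

(** The profile (with [b = 0]), the surface and all velocities have this shape, so one formula for
    the inner product serves all of them. Of the family [a] only the indices 1 and 3, ..., n-2 are
    read. *)
Definition frame (a : nat -> R) (b p q : R) : 'rV[R]_n :=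
  a 1%N *: e_ n 1 + b *: e_ n 2 + \sum_(3 <= k < n.-1) a k *: e_ n k
  + p *: xi_n1 n + q *: xi_n n.

Lemma profileE (x : nat -> R -> R) (u : R) :
  profile n x u = frame (x^~ u) 0 (x n.-1 u) (x n u).
Proof. by rewrite /frame scale0r addr0. Qed.

End Frame.

(** The two null vectors mix only the last two coordinates. Ordinals count from zero, so $e_k$
    occupies position $k-1$; writing the dimension as [m.+4] keeps the positions 0, 1, [m.+2] and
    [m.+3] distinct. *)
Lemma frame_coord (R : realType) (m : nat) (a : nat -> R) (b p q : R)
    (i : 'I_m.+4) :
  frame m.+4 a b p q 0 i =
    if i == 0%N :> nat then a 1%N else if i == 1%N :> nat then b
    else if i == m.+2 :> nat then (Num.sqrt 2)^-1 * (q - p)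
    else if i == m.+3 :> nat then (Num.sqrt 2)^-1 * (p + q)
    else a i.+1.
Proof.
rewrite /frame /xi_n1 /xi_n !mxE summxE.
under eq_bigr do rewrite !mxE.
case: i => i im /=; rewrite !eqSS.
(* At most the term $k = i+1$ survives, and $3 \le i+1 < m+3$ reads $1 < i < m+2$. *)
have -> : \sum_(3 <= k < m.+3) a k * (i.+1 == k)%:R =
    if (1 < i < m.+2)%N then a i.+1 else 0 :> R.
  case: ifPn => [/andP[i1 im2]|ni].
    rewrite (bigD1_seq i.+1) ?iota_uniq ?mem_index_iota ?ltnS ?i1//=.
    rewrite eqxx mulr1 big1 ?addr0// => k /negPf; rewrite eq_sym => ->.
    by rewrite mulr0.
  rewrite big_nat big1// => k /andP[k3 km]; case: eqP => [ik|]; last first.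
    by rewrite mulr0.
  by case/negP: ni; rewrite -ltnS -[(i < m.+2)%N]ltnS ik k3.
have [->|i0] := eqVneq i 0%N.
  by rewrite /= !(mulr1, mulr0, subrr, addr0).
have [->|i1] := eqVneq i 1%N.
  by rewrite /= !(mulr1, mulr0, subrr, addr0, add0r).
have [->|i2] := eqVneq i m.+2.
  rewrite ltnn andbF /= eqn_leq ltnn andbF /= !(mulr0, add0r).
  by ring.
have [->|i3] := eqVneq i m.+3.
  rewrite [(m.+3 < m.+2)%N]ltnNge leqnSn /= !(mulr0, add0r).
  by rewrite subr0 addr0 !mulr1 mulrDr mulrC [q * _]mulrC.
have -> : (1 < i < m.+2)%N.
  move: im; rewrite !ltnS leq_eqVlt (negPf i3)/= ltnS leq_eqVlt (negPf i2)/=.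
  by case: i i0 i1 {i2 i3} => [|[|]].
by rewrite /= !(subrr, mulr0, addr0, add0r).
Qed.

(** The last two coordinates are $(q-p)/\sqrt2$ and $(p+q)/\sqrt2$; the difference of their products
    leaves $-(pq'+p'q)$, which expresses that both null vectors are isotropic with product $-1$. *)
Lemma mink_frame (R : realType) (m : nat) (a a' : nat -> R)
    (b b' p p' q q' : R) :
  mink (frame m.+4 a b p q) (frame m.+4 a' b' p' q') =
  a 1%N * a' 1%N + b * b' + \sum_(3 <= k < m.+3) a k * a' k
  - (p * q' + p' * q).
Proof.
rewrite /mink; under eq_bigr do rewrite !frame_coord.
rewrite big_ord_recr big_ord_recr big_ord_recl big_ord_recl /=.
rewrite !eqxx !eqSS /= !(gtn_eqF (ltnSn _)).
have -> : \sum_(3 <= k < m.+3) a k * a' k = \sum_(i < m) a i.+3 * a' i.+3.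
  rewrite (@big_addn _ _ _ 0 m.+3 3) -[m.+3]addn3 addnK big_mkord.
  by apply: eq_bigr => i _; rewrite addn3.
have s2 y z : (Num.sqrt 2)^-1 * y * ((Num.sqrt 2)^-1 * z) = y * z / 2 :> R.
  by rewrite mulrACA -invfM -expr2 sqr_sqrtr// mulrC.
rewrite (ltn_eqF (ltnSn m)) !s2.
under eq_bigr => i _.
  rewrite /= !eqSS (ltn_eqF (ltn_ord i)) ltn_eqF; last exact/ltnW/ltn_ord.
  over.
by field.
Qed.

(** * Derivatives of curves in the frame, and velocities on the surface *)

Lemma is_derive_scalel (R : realType) (V : normedModType R) (f : R -> R)
    (df : R) (w : V) (t : R) :
  is_derive t 1 f df -> is_derive t 1 (fun s => f s *: w) (df *: w).
Proof.
move=> [fcvg <-].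
have cvgZ : (fun h => h^-1 *: ((f \o shift t) (h *: 1) *: w - f t *: w))
    @ 0^' --> 'D_1 f t *: w.
  have -> : (fun h => h^-1 *: ((f \o shift t) (h *: 1) *: w - f t *: w)) =
      (fun h => (h^-1 *: ((f \o shift t) (h *: 1) - f t)) *: w).
    by apply/funext => h; rewrite -scalerBl scalerA.
  by apply: cvgZr_tmp; exact: fcvg.
apply: DeriveDef; first by apply/cvg_ex; eexists; exact: cvgZ.
exact/cvg_lim/cvgZ.
Qed.

Lemma is_derive_big (R : realType) (V : normedModType R) (T : eqType)
    (r : seq T) (f : T -> R -> V) (df : T -> V) (t : R) :
  (forall k, k \in r -> is_derive t 1 (f k) (df k)) ->
  is_derive t 1 (fun s => \sum_(k <- r) f k s) (\sum_(k <- r) df k).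
Proof.
elim: r => [|k r IH] fr.
  rewrite big_nil [X in is_derive _ _ X](_ : _ = cst 0).
    exact: is_derive_cst.
  by apply/funext => s; rewrite big_nil.
rewrite big_cons.
rewrite [X in is_derive _ _ X](_ : _ = f k + (fun s => \sum_(j <- r) f j s)).
  apply: is_deriveD; first by apply: fr; rewrite mem_head.
  by apply: IH => j jr; apply: fr; rewrite in_cons jr orbT.
by apply/funext => s; rewrite big_cons.
Qed.

Lemma is_derive_frame (R : realType) (n : nat) (t : R)
    (a : nat -> R -> R) (b p q : R -> R) (da : nat -> R) (db dp dq : R) :
  is_derive t 1 (a 1%N) (da 1%N) ->
  (forall k, (3 <= k < n.-1)%N -> is_derive t 1 (a k) (da k)) ->
  is_derive t 1 b db -> is_derive t 1 p dp -> is_derive t 1 q dq ->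
  is_derive t 1 (fun s => frame n (a^~ s) (b s) (p s) (q s))
                (frame n da db dp dq).
Proof.
move=> a1 ak hb hp hq.
apply: (@is_deriveD _ _ _ (fun s => _ + _) (fun s => _)).
  apply: (@is_deriveD _ _ _ (fun s => _ + _) (fun s => _)).
    apply: (@is_deriveD _ _ _ (fun s => _ + _) (fun s => _)).
      by apply: (@is_deriveD _ _ _ (fun s => _ *: _) (fun s => _ *: _));
        apply: is_derive_scalel.
    apply: is_derive_big => k; rewrite mem_index_iota => /ak.
    exact: is_derive_scalel.
  exact: is_derive_scalel.
exact: is_derive_scalel.
Qed.

(** This is the derivative of $H_3(u(t),v(t))$ by the chain rule, with [X] for $x_n$, [dx k] for
    $x_k'$, and [U], [V] for $u'$, $v'$. *)
Definition velocity (R : realType) (n : nat) (c : R) (dx : nat -> R)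
    (X v U V : R) : 'rV[R]_n :=
  frame n (fun k => dx k * U) (Num.sqrt 2 * (V * X + v * (dx n * U)))
    (dx n.-1 * U + (2 * v * V * X + v ^+ 2 * (dx n * U)) + c * V) (dx n * U).

(** All terms in [v] from the $e_2$ component cancel against those from the null components: moving
    along $v$ is an ambient isometry. Hence the slope of a loxodrome depends on $u$ alone. *)
Lemma mink_velocity (R : realType) (m : nat) (c eps : R) (dx : nat -> R)
    (X v U V U' V' : R) :
  mink (frame m.+4 dx 0 (dx m.+3) (dx m.+4))
       (frame m.+4 dx 0 (dx m.+3) (dx m.+4)) = eps ->
  mink (velocity m.+4 c dx X v U V) (velocity m.+4 c dx X v U' V') =
  eps * (U * U') - c * dx m.+4 * (U * V' + U' * V) + 2 * X ^+ 2 * (V * V').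
Proof.
rewrite /velocity !mink_frame => <-.
have -> : \sum_(3 <= k < m.+3) dx k * U * (dx k * U') =
    (\sum_(3 <= k < m.+3) dx k * dx k) * (U * U').
  by rewrite big_distrl; apply: eq_bigr => k _; rewrite mulrACA.
have s2 y z : Num.sqrt 2 * y * (Num.sqrt 2 * z) = 2 * y * z :> R.
  by rewrite mulrACA -expr2 sqr_sqrtr// mulrA.
by rewrite s2 /=; ring.
Qed.

(** Both parameters vary, so the partial derivatives of the surface are the cases where one of them
    is constant. *)
Lemma is_derive_H3 (R : realType) (n : nat) (c : R) (x : nat -> R -> R)
    (dx : nat -> R) (u v : R -> R) (t U V : R) :
  (3 < n)%N ->
  (forall k, (1 <= k <= n)%N -> k != 2%N ->
    is_derive (u t) 1 (x k) (dx k)) ->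
  is_derive t 1 u U -> is_derive t 1 v V ->
  is_derive t 1 (fun s => H3 n c x (u s) (v s))
    (velocity n c dx (x n (u t)) (v t) U V).
Proof.
move=> n3 hx hu hv.
have hxu k : (1 <= k <= n)%N -> k != 2%N ->
    is_derive t 1 (fun s => x k (u s)) (dx k * U).
  by move=> kn k2; exact: (@is_derive1_comp _ (x k) u t _ _ (hx k kn k2) hu).
have n0 : (0 < n)%N by apply: leq_trans n3.
have hn : is_derive t 1 (fun s => x n (u s)) (dx n * U).
  by apply: hxu; [rewrite n0 leqnn|rewrite gtn_eqF// ltnW].
have hn1 : is_derive t 1 (fun s => x n.-1 (u s)) (dx n.-1 * U).
  by apply: hxu; case: (n) n3 => [|[|[|[|k]]]] //= _; exact: ltnW.
apply: (@is_derive_frame _ _ _ (fun k s => x k (u s))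
  (fun s => Num.sqrt 2 * v s * x n (u s))
  (fun s => x n.-1 (u s) + v s ^+ 2 * x n (u s) + c * v s)) => //.
- by apply: hxu.
- move=> k /andP[k3 kn]; apply: hxu; last by rewrite gtn_eqF.
  by rewrite (leq_trans _ k3)//= ltnW// (leq_trans kn)// leq_pred.
- have := @is_deriveM _ _ (fun s => Num.sqrt 2 * v s) (fun s => x n (u s)) t 1
    _ _ (@is_deriveZ _ _ _ v (Num.sqrt 2) t 1 _ hv) hn.
  move/is_derive_eq; apply; rewrite /= /GRing.scale/=; ring.
- have hv2 := @is_deriveM _ _ v v t 1 _ _ hv hv.
  have := @is_deriveD _ _ _ _ _ t 1 _ _ (@is_deriveD _ _ _ _ _ t 1 _ _ hn1
    (@is_deriveM _ _ _ _ t 1 _ _ hv2 hn)) (@is_deriveZ _ _ _ v c t 1 _ hv).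
  rewrite [X in is_derive _ _ X _ -> _](_ : _ =
    (fun s => x n.-1 (u s) + v s ^+ 2 * x n (u s) + c * v s)).
    move/is_derive_eq; apply.
    (* The goal differs from this scalar identity only by scalings that unfold to products. *)
    have E (y z w r p q : R) : y + (z * z * w + r * (z * p + z * p)) + q =
        y + (2 * z * p * r + z ^+ 2 * w) + q by ring.
    exact: E.
  by apply/funext => s; rewrite expr2.
Qed.

Lemma derive1_is_derive (R : realType) (V : normedModType R) (f : R -> V)
  (t : R) (df : V) : is_derive t 1 f df -> derive1 f t = df.
Proof. by move=> [_ <-]; rewrite derive1E. Qed.

Lemma smooth_on_is_derive (R : realType) (I : set R) (f : R -> R) (t : R) :
  smooth_on I f -> I t -> is_derive t 1 f (derive1 f t).
Proof. by move=> /(_ 0%N t) h /h; rewrite derive1E => /derivableP. Qed.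

Lemma smooth_on_continuous (R : realType) (I : set R) (f : R -> R) (t : R) :
  smooth_on I f -> I t -> {for t, continuous f}.
Proof.
by move=> /(_ 0%N t) h /h dt; exact/differentiable_continuous/derivable1_diffP.
Qed.

Lemma smooth_on_continuous1 (R : realType) (I : set R) (f : R -> R) (t : R) :
  smooth_on I f -> I t -> {for t, continuous (derive1 f)}.
Proof.
by move=> /(_ 1%N t) h /h dt; exact/differentiable_continuous/derivable1_diffP.
Qed.

(** * Hyperbolic identities, and the squared angle condition *)

Lemma sqr_cosh (R : realType) (y : R) : cosh y ^+ 2 = 1 + sinh y ^+ 2.
Proof.
have e1 : expR y * expR (- y) = 1 by rewrite -expRD subrr expR0.
rewrite /cosh /sinh; move: (expR y) (expR (- y)) e1 => a b ab.
transitivity (a * b + ((a - b) / 2) ^+ 2); first by field.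
by rewrite ab.
Qed.

Lemma sinh_double (R : realType) (y : R) : sinh (2 * y) = 2 * sinh y * cosh y.
Proof.
rewrite /sinh /cosh -mulrN -[2]/(1 + 1 : R) !mulrDl !mul1r !expRD.
by field.
Qed.

Lemma sqr_sinh_double (R : realType) (y : R) :
  sinh (2 * y) ^+ 2 = 4 * sinh y ^+ 2 * cosh y ^+ 2.
Proof. by rewrite sinh_double; ring. Qed.

Lemma sinh_gt0 (R : realType) (y : R) : 0 < y -> 0 < sinh y.
Proof. by move=> y0; rewrite divr_gt0// subr_gt0 ltr_expR; lra. Qed.

Lemma sqr_mnorm (R : realType) (n : nat) (w : 'rV[R]_n) :
  mnorm w ^+ 2 = `|mink w w|.
Proof. exact: sqr_sqrtr. Qed.

Lemma mink00 (R : realType) (n : nat) : mink (0 : 'rV[R]_n) 0 = 0.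
Proof. by rewrite /mink big1// => i _; rewrite mxE mulr0 oppr0 if_same. Qed.

(** Squaring absorbs the sign in the definition of the angle; the case of two timelike vectors
    contradicts $\langle y,y\rangle = 1$. *)
Lemma timelike_angle_spacelike (R : realType) (n : nat) (y w : 'rV[R]_n)
    (theta : R) :
  mink y y = 1 -> timelike w -> timelike_angle y w theta ->
  mink y w ^+ 2 = - mink w w * sinh theta ^+ 2.
Proof.
rewrite /timelike => yy ww [_ [[_ yw]|[]]]; last by rewrite /timelike yy ltr10.
have -> : mink y w ^+ 2 = (mnorm y * mnorm w * sinh theta) ^+ 2.
  by case: yw => ->//; rewrite sqrrN.
by rewrite !exprMn !sqr_mnorm yy normr1 mul1r ltr0_norm.
Qed.

(** Neither vector is spacelike, the zero vector included, so only the $\cosh$ alternative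
    remains. *)
Lemma timelike_angle_timelike (R : realType) (n : nat) (y w : 'rV[R]_n)
    (theta : R) :
  mink y y = -1 -> timelike w -> timelike_angle y w theta ->
  mink y w ^+ 2 = - mink w w * cosh theta ^+ 2.
Proof.
rewrite /timelike => yy ww [_ [[[[+ _]|[_ +]] _]|[_ _ ->]]].
- case=> [|y0]; first by rewrite yy ltr0N1.
  by move: yy; rewrite y0 mink00 => /eqP; rewrite eq_sym oppr_eq0 oner_eq0.
- case=> [|w0]; first by rewrite ltNge ltW.
  by move: ww; rewrite w0 mink00 ltxx.
- by rewrite !exprMn !sqr_mnorm yy normrN normr1 mul1r ltr0_norm.
Qed.

(** Completing the square in [V]: once $\cosh^2$ is replaced by $1+\sinh^2$, the difference of the
    two sides is the hypothesis multiplied by twice the coefficient of [V]. *)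
Lemma slope_i_quadratic (R : realType) (c phi d X U V : R) :
  (U - c * d * V) ^+ 2 =
    - (U ^+ 2 - 2 * c * d * (U * V) + 2 * X ^+ 2 * V ^+ 2) * sinh phi ^+ 2 ->
  ((4 * sinh phi ^+ 2 * X ^+ 2 + 2 * c ^+ 2 * d ^+ 2) * V
    - 2 * c * cosh phi ^+ 2 * d * U) ^+ 2 =
  sinh (2 * phi) ^+ 2 * (c ^+ 2 * d ^+ 2 - 2 * X ^+ 2) * U ^+ 2.
Proof.
move=> H; apply/eqP; rewrite -subr_eq0; apply/eqP.
rewrite sqr_sinh_double; move: H (sqr_cosh phi).
move: (sinh phi ^+ 2) (cosh phi ^+ 2) => S C H E; rewrite {}E.
transitivity ((4 * S * X ^+ 2 + 2 * c ^+ 2 * d ^+ 2) * 2 *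
  ((U - c * d * V) ^+ 2
   + (U ^+ 2 - 2 * c * d * (U * V) + 2 * X ^+ 2 * V ^+ 2) * S)).
  by ring.
by rewrite H; ring.
Qed.

(** The same completion of the square for $\varepsilon=-1$, with $\sinh$ and $\cosh$ exchanged. *)
Lemma slope_ii_quadratic (R : realType) (c phi d X U V : R) :
  (- U - c * d * V) ^+ 2 =
    - (- U ^+ 2 - 2 * c * d * (U * V) + 2 * X ^+ 2 * V ^+ 2) * cosh phi ^+ 2 ->
  ((4 * cosh phi ^+ 2 * X ^+ 2 + 2 * c ^+ 2 * d ^+ 2) * V
    - 2 * c * sinh phi ^+ 2 * d * U) ^+ 2 =
  sinh (2 * phi) ^+ 2 * (2 * X ^+ 2 + c ^+ 2 * d ^+ 2) * U ^+ 2.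
Proof.
move=> H; apply/eqP; rewrite -subr_eq0; apply/eqP.
rewrite sqr_sinh_double; move: H (sqr_cosh phi).
move: (sinh phi ^+ 2) (cosh phi ^+ 2) => S C + E; rewrite {}E => H.
transitivity ((4 * (1 + S) * X ^+ 2 + 2 * c ^+ 2 * d ^+ 2) * 2 *
  ((- U - c * d * V) ^+ 2
   + (- U ^+ 2 - 2 * c * d * (U * V) + 2 * X ^+ 2 * V ^+ 2) * (1 + S))).
  by ring.
by rewrite H; ring.
Qed.

(** * Segments inside an open interval, and the oriented integral *)

Lemma open_interval_enlarge (R : realType) (I : set R) (w : R) :
  open_interval I -> I w -> exists d e, [/\ I d, I e, d < w & w < e].
Proof.
move=> [oI _ _] Iw; have [r /= r0 rI] := open_nbhs_nbhs (conj oI Iw).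
have r20 : 0 < r / 2 by rewrite divr_gt0.
have r2r : r / 2 < r by rewrite ltr_pdivrMr// ltr_pMr// ltr1n.
exists (w - r / 2), (w + r / 2); split.
- by apply: rI; rewrite /ball /= opprB addrC subrK gtr0_norm.
- by apply: rI; rewrite /ball /= opprD addNKr normrN gtr0_norm.
- by rewrite ltrBlDr ltrDl.
- by rewrite ltrDl.
Qed.

(** Provides a segment with both points in its interior, as the fundamental theorem of calculus
    requires at the point of differentiation. *)
Lemma open_interval_hull (R : realType) (I : set R) (a b : R) :
  open_interval I -> I a -> I b ->
  exists d e, [/\ I d, I e, d < a, d < b & (a < e) /\ (b < e)].
Proof.
move=> hI Ia Ib.
have [d1 [e1 [Id1 Ie1 d1a ae1]]] := open_interval_enlarge hI Ia.
have [d2 [e2 [Id2 Ie2 d2b be2]]] := open_interval_enlarge hI Ib.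
exists (Num.min d1 d2), (Num.max e1 e2); split.
- by rewrite minEle; case: ifP.
- by rewrite maxEle; case: ifP.
- by rewrite gt_min d1a.
- by rewrite gt_min d2b orbT.
- by rewrite !lt_max ae1 be2 orbT.
Qed.

Lemma is_interval_segment (R : realType) (I : set R) (a b z : R) :
  is_interval I -> I a -> I b -> z \in `[a, b]%R -> I z.
Proof. by move=> iI Ia Ib; rewrite in_itv; apply: iI. Qed.

Lemma continuous_on_segment (R : realType) (I : set R) (f : R -> R) (a b : R) :
  is_interval I -> (forall z, I z -> {for z, continuous f}) ->
  I a -> I b -> {within `[a, b], continuous f}.
Proof.
move=> iI cf Ia Ib; apply: continuous_in_subspaceT => z.
by rewrite inE /= => zab; exact/cf/(is_interval_segment iI Ia Ib).
Qed.

(** Measuring both integrals from a common left end [d] removes the case distinction on the order of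
    [a] and [b]. *)
Lemma oriented_integralE (R : realType) (f : R -> R) (d e a b : R) :
  {within `[d, e], continuous f} -> d <= a -> d <= b -> a <= e -> b <= e ->
  oriented_integral a b f =
  \int[lebesgue_measure]_(z in `[d, b]) f z -
  \int[lebesgue_measure]_(z in `[d, a]) f z.
Proof.
move=> cf.
have main p q : d <= p -> p <= q -> q <= e ->
    \int[lebesgue_measure]_(z in `[p, q]) f z =
    \int[lebesgue_measure]_(z in `[d, q]) f z -
    \int[lebesgue_measure]_(z in `[d, p]) f z.
  move=> dp pq qe.
  have idq : lebesgue_measure.-integrable `[d, q] (EFin \o f).
    apply: continuous_compact_integrable; first exact: segment_compact.
    by apply: continuous_subspaceW cf; apply: subset_itvl; rewrite bnd_simp.
  rewrite Rintegral_itvB ?bnd_simp//.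
  rewrite Rintegral_itv_obnd_cbnd//.
  by apply: integrableS idq => //; apply: subset_itvr; rewrite bnd_simp.
move=> da db ae be; rewrite /oriented_integral.
have [ab|/ltW ba] := leP a b; first exact: main.
by rewrite (main b a)// opprB.
Qed.

Lemma oriented_integral_refl (R : realType) (f : R -> R) (a : R) :
  oriented_integral a a f = 0.
Proof. by rewrite /oriented_integral lexx set_itv1 Rintegral_set1. Qed.

Lemma is_derive_oriented_integral (R : realType) (I : set R) (f : R -> R)
    (a w : R) :
  open_interval I -> (forall z, I z -> {for z, continuous f}) ->
  I a -> I w ->
  is_derive w 1 (fun b => oriented_integral a b f) (f w).
Proof.
move=> hI cf Ia Iw; have [_ iI _] := hI.
have [d [e [Id Ie da dw [ae we]]]] := open_interval_hull hI Ia Iw.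
have cde := continuous_on_segment iI cf Id Ie.
have ide : lebesgue_measure.-integrable `[d, e] (EFin \o f).
  by apply: continuous_compact_integrable => //; exact: segment_compact.
have [dF F'] := continuous_FTC1_closed we ide dw (cf _ Iw).
pose F b := \int[lebesgue_measure]_(z in `[d, b]) f z.
(* The oriented integral equals $F(b)-F(a)$ for $b$ between [d] and [e], hence near [w], which
   suffices for the derivative. *)
apply: (@near_eq_is_derive _ _ _ (F - cst (F a))).
  near=> b; rewrite (@oriented_integralE _ _ d e) ?ltW//.
  - by near: b; exact: lt_nbhsr.
  - by near: b; exact: lt_nbhsl.
rewrite -[f w]subr0; apply: is_deriveB.
by apply: DeriveDef => //; rewrite -derive1E.
Unshelve. all: by end_near. Qed.

(** * Functions on an interval, and integration of the slope equation *)

Lemma derive_eq_cst (R : realType) (J : set R) (f : R -> R) (s t : R) :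
  is_interval J -> (forall z, J z -> is_derive z 1 f 0) -> J s -> J t ->
  f s = f t.
Proof.
move=> iJ df; wlog st : s t / s <= t.
  by move=> H Js Jt; have [/H->|/ltW/H->] := leP s t.
move=> Js Jt; apply/eqP; rewrite eq_sym -subr_eq0; apply/eqP.
have [||z _ ->] := @MVT_segment _ f (cst 0) s t st; last by rewrite mul0r.
  move=> z zst; apply/df/(is_interval_segment iJ Js Jt).
  exact: subset_itv_oo_cc zst.
apply: (continuous_on_segment iJ) => // z /df[dz _].
exact/differentiable_continuous/derivable1_diffP.
Qed.

Lemma derive1_neq0_inj (R : realType) (J : set R) (u : R -> R) :
  is_interval J -> (forall t, J t -> derivable u t 1) ->
  (forall t, J t -> derive1 u t != 0) ->
  forall s t, J s -> J t -> u s = u t -> s = t.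
Proof.
move=> iJ du u'0 s t; wlog st : s t / s <= t.
  move=> H Js Jt ust; have [le|/ltW le] := leP s t; first exact: H.
  by apply/esym/H.
move=> Js Jt ust; move: st; rewrite le_eqVlt => /predU1P[//|st].
have Jst z : z \in `]s, t[%R -> J z.
  by move=> zst; apply: (is_interval_segment iJ Js Jt (subset_itv_oo_cc zst)).
have [| |z zst [_ dz]] := Rolle st _ _ ust.
- by move=> z /Jst; exact: du.
- apply: (continuous_on_segment iJ) => // z /du dz.
  exact/differentiable_continuous/derivable1_diffP.
- by have := u'0 _ (Jst _ zst); rewrite derive1E dz eqxx.
Qed.

(** Values of both signs would force a zero by the intermediate value theorem. *)
Lemma continuous_neq0_sign (R : realType) (J : set R) (g : R -> R) :
  is_interval J -> (forall z, J z -> {for z, continuous g}) ->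
  (forall t, J t -> g t != 0) ->
  exists s : bool, forall t, J t -> g t = (-1) ^+ s * `|g t|.
Proof.
move=> iJ cg g0.
have [[t0 [Jt0 gt0]]|gpos] := pselect (exists t, J t /\ g t < 0); last first.
  exists false => t Jt; rewrite mul1r ger0_norm// leNgt; apply/negP => gt0.
  by apply: gpos; exists t.
exists true => t Jt; rewrite mulN1r ltr0_norm ?opprK// ltNge; apply/negP => gt.
suff : exists2 z, J z & g z = 0 by case=> z /g0/eqP.
have [tt|/ltW tt] := leP t t0.
- have [|z zin <-] := IVT tt (continuous_on_segment iJ cg Jt Jt0) (v := 0).
    by rewrite ge_min le_max gt (ltW gt0) orbT.
  by exists z => //; exact: (is_interval_segment iJ Jt Jt0).
- have [|z zin <-] := IVT tt (continuous_on_segment iJ cg Jt0 Jt) (v := 0).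
    by rewrite ge_min le_max gt (ltW gt0) orbT.
  by exists z => //; exact: (is_interval_segment iJ Jt0 Jt).
Qed.

(* Off the zeros of [u'] the equation reads [(A v'/u' - B)^2 = D > 0], so by
   connectedness a single branch of the square root is used along the curve. *)
Lemma quadratic_slope_integral (R : realType) (I J : set R) (A B D : R -> R)
    (u v : R -> R) (u0 : R) :
  open_interval I -> open_interval J ->
  (forall z, I z -> {for z, continuous A}) ->
  (forall z, I z -> {for z, continuous B}) ->
  (forall z, I z -> {for z, continuous D}) ->
  (forall z, I z -> 0 < A z) -> (forall z, I z -> 0 < D z) ->
  (forall t, J t -> derivable u t 1) -> (forall t, J t -> derivable v t 1) ->
  (forall t, J t -> {for t, continuous (derive1 u)}) ->
  (forall t, J t -> {for t, continuous (derive1 v)}) ->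
  (forall t, J t -> I (u t)) ->
  (forall t, J t -> derive1 u t != 0) ->
  (forall t, J t -> (A (u t) * derive1 v t - B (u t) * derive1 u t) ^+ 2 =
                    D (u t) * derive1 u t ^+ 2) ->
  I u0 ->
  exists (V : R -> R) (s : bool),
    (forall t, J t -> v t = V (u t)) /\
    (forall w, I w -> V w = V u0 + oriented_integral u0 w
       (fun z => (B z + (-1) ^+ s * Num.sqrt (D z)) / A z)).
Proof.
move=> hI hJ cA cB cD A0 D0 du dv cu' cv' IJ u'0 quad Iu0.
have [_ iJ [t0 Jt0]] := hJ.
pose g t := (A (u t) * derive1 v t - B (u t) * derive1 u t) / derive1 u t.
have cu t : J t -> {for t, continuous u}.
  by move=> Jt; exact/differentiable_continuous/derivable1_diffP/du.
have cg t : J t -> {for t, continuous g}.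
  move=> Jt; have cAu : {for t, continuous (A \o u)}.
    by apply: continuous_comp; [exact: cu|exact/cA/IJ].
  have cBu : {for t, continuous (B \o u)}.
    by apply: continuous_comp; [exact: cu|exact/cB/IJ].
  apply: cvgM; last by apply: cvgV; [exact: u'0|exact: cu'].
  by apply: cvgB; apply: cvgM; [exact: cAu|exact: cv'|exact: cBu|exact: cu'].
have g2 t : J t -> g t ^+ 2 = D (u t).
  by move=> Jt; rewrite /g expr_div_n quad// mulfK// expf_neq0// u'0.
have g0 t : J t -> g t != 0.
  by move=> Jt; rewrite -sqrf_eq0 g2//; exact/lt0r_neq0/D0/IJ.
have [s gs] := continuous_neq0_sign iJ cg g0.
pose f z := (B z + (-1) ^+ s * Num.sqrt (D z)) / A z.
have cf z : I z -> {for z, continuous f}.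
  move=> Iz; apply: cvgM; last first.
    by apply: cvgV; [exact/lt0r_neq0/A0|exact: cA].
  apply: cvgD; first exact: cB.
  apply: cvgM; first exact: cvg_cst.
  by apply: (@continuous_comp _ _ _ D); [exact: cD|exact: sqrt_continuous].
have v'E t : J t -> derive1 v t = f (u t) * derive1 u t.
  move=> Jt; rewrite /f -g2// sqrtr_sqr -gs// /g.
  have := u'0 _ Jt; have : A (u t) != 0 by exact/lt0r_neq0/A0/IJ.
  by move=> *; field; apply/andP.
(* The point [u0] may lie outside the range of [u], so the constant is fixed by matching [v] at
   [t0]; this defines $V$ on all of [I]. *)
pose C := v t0 - oriented_integral u0 (u t0) f.
(* That $V(u(t)) = v(t)$ follows because $v$ minus the integral up to $u(t)$ has zero derivative
   along [J]. *)
exists (fun w => C + oriented_integral u0 w f), s; split; last first.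
  by move=> w Iw; rewrite oriented_integral_refl addr0.
pose h t := v t - oriented_integral u0 (u t) f.
suff hE t : J t -> h t = h t0.
  by move=> t Jt; rewrite /C -[_ - _](hE _ Jt) subrK.
move=> Jt; apply: (derive_eq_cst iJ) => // z Jz.
have dint : is_derive z 1 ((fun w => oriented_integral u0 w f) \o u)
                          (f (u z) * derive1 u z).
  apply: is_derive1_comp.
    exact: (is_derive_oriented_integral hI cf Iu0 (IJ _ Jz)).
  by rewrite derive1E; exact/derivableP/du.
have dv' : is_derive z 1 v (derive1 v z).
  by rewrite derive1E; exact/derivableP/dv.
have -> : 0 = derive1 v z - f (u z) * derive1 u z by rewrite v'E// subrr.
exact: is_deriveB.
Qed.

(** * The first fundamental form, and loxodromes on the surface *)

Section Loxodrome.
Variables (R : realType) (m : nat) (I : set R) (x : nat -> R -> R).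
Variables (eps c : R).
Hypothesis hx : smooth_profile m.+4 x I.
Hypothesis hbeta : arc_length_profile m.+4 x I eps.

Let dx z k := derive1 (x k) z.

Let is_derive_x z k : I z -> (1 <= k <= m.+4)%N -> k != 2%N ->
  is_derive z 1 (x k) (dx z k).
Proof. by move=> Iz kn k2; exact: smooth_on_is_derive (hx kn k2) Iz. Qed.

(** With $X = x_n$ it contains $E=\varepsilon$, $F=-c\,x_n'$ and $G=2x_n^2$; the arc length
    condition supplies $\varepsilon$. *)
Let first_form z (X w U V U' V' : R) : I z ->
  mink (velocity m.+4 c (dx z) X w U V) (velocity m.+4 c (dx z) X w U' V') =
  eps * (U * U') - c * dx z m.+4 * (U * V' + U' * V) + 2 * X ^+ 2 * (V * V').
Proof.
move=> Iz; apply: mink_velocity; rewrite -(hbeta Iz).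
suff -> : derive1 (profile m.+4 x) z =
    frame m.+4 (dx z) 0 (dx z m.+3) (dx z m.+4) by [].
apply: derive1_is_derive.
have -> : profile m.+4 x =
    (fun s => frame m.+4 (x^~ s) (cst 0 s) (x m.+3 s) (x m.+4 s)).
  by apply/funext => s; rewrite profileE.
apply: is_derive_frame; first exact: is_derive_x.
- move=> k /andP[k3 km]; apply: is_derive_x => //; last by rewrite gtn_eqF.
  by rewrite (leq_trans _ k3)//= ltnW// (leq_trans km).
- by apply: is_derive_x; rewrite //= leqnSn.
- by apply: is_derive_x; rewrite //= leqnn.
Qed.

Lemma H3_uE z w : I z ->
  H3_u m.+4 c x z w = velocity m.+4 c (dx z) (x m.+4 z) w 1 0.
Proof.
move=> Iz; apply: derive1_is_derive.
by apply: (@is_derive_H3 _ _ _ _ _ id (cst w)) => // k; exact: is_derive_x.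
Qed.

Lemma H3_vE z w : I z ->
  H3_v m.+4 c x z w = velocity m.+4 c (dx z) (x m.+4 z) w 0 1.
Proof.
move=> Iz; apply: derive1_is_derive.
by apply: (@is_derive_H3 _ _ _ _ _ (cst z) id) => // k; exact: is_derive_x.
Qed.

Lemma timelike_surfaceE z : timelike_surface m.+4 c x I -> I z ->
  2 * eps * x m.+4 z ^+ 2 - c ^+ 2 * derive1 (x m.+4) z ^+ 2 < 0.
Proof.
move=> hS Iz; have := hS z 0 Iz; rewrite /= H3_uE// H3_vE// !first_form//.
by apply: le_lt_trans; rewrite le_eqVlt; apply/predU1P; left; rewrite /dx; ring.
Qed.

Variables (J : set R) (u v : R -> R) (phi0 : R).
Hypothesis hlox : timelike_loxodrome m.+4 c x I J u v phi0.

Let alpha t := H3 m.+4 c x (u t) (v t).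

Lemma alpha'E t : J t -> derive1 alpha t =
  velocity m.+4 c (dx (u t)) (x m.+4 (u t)) (v t) (derive1 u t) (derive1 v t).
Proof.
case: hlox => su sv uI _ _ Jt; apply: derive1_is_derive.
apply: is_derive_H3 => //.
- by move=> k; apply: is_derive_x; exact: uI.
- exact: smooth_on_is_derive su Jt.
- exact: smooth_on_is_derive sv Jt.
Qed.

Lemma mink_alpha' t : J t ->
  mink (derive1 alpha t) (derive1 alpha t) =
  eps * derive1 u t ^+ 2
  - 2 * c * derive1 (x m.+4) (u t) * (derive1 u t * derive1 v t)
  + 2 * x m.+4 (u t) ^+ 2 * derive1 v t ^+ 2.
Proof.
move=> Jt; rewrite alpha'E// first_form; last first.
  by case: hlox => ? ? uI _ _; exact: uI.
by rewrite /dx; ring.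
Qed.

Lemma mink_H3_u_alpha' t : J t ->
  mink (H3_u m.+4 c x (u t) (v t)) (derive1 alpha t) =
  eps * derive1 u t - c * derive1 (x m.+4) (u t) * derive1 v t.
Proof.
move=> Jt; have Iut : I (u t) by case: hlox => ? ? uI _ _; exact: uI.
by rewrite alpha'E// H3_uE// first_form// /dx; ring.
Qed.

Lemma mink_H3_u t : J t ->
  mink (H3_u m.+4 c x (u t) (v t)) (H3_u m.+4 c x (u t) (v t)) = eps.
Proof.
move=> Jt; have Iut : I (u t) by case: hlox => ? ? uI _ _; exact: uI.
by rewrite H3_uE// first_form//; ring.
Qed.

(* If [u' = 0], the equation forces [v' = 0], against [alpha] being timelike. *)
Lemma derive1_u_neq0 t (A B D : R) : J t -> A != 0 ->
  (A * derive1 v t - B * derive1 u t) ^+ 2 = D * derive1 u t ^+ 2 ->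
  derive1 u t != 0.
Proof.
move=> Jt A0 quad; apply/eqP => u0; move: quad.
rewrite u0 expr0n /= !mulr0 subr0 => /eqP; rewrite sqrf_eq0 mulf_eq0 (negPf A0).
move=> /eqP v0; case: hlox => _ _ _ /(_ t Jt) + _.
by rewrite /timelike mink_alpha'// u0 v0 !expr0n /= !mulr0 subrr addr0 ltxx.
Qed.

(** Shared by both types of meridian: positivity of [A] yields $u' \ne 0$, and positivity of [D]
    yields a single sign of the root. *)
Lemma loxodrome_integral (A B D : R -> R) (u0 : R) :
  open_interval I -> open_interval J ->
  (forall z, I z -> {for z, continuous A}) ->
  (forall z, I z -> {for z, continuous B}) ->
  (forall z, I z -> {for z, continuous D}) ->
  (forall z, I z -> 0 < A z) -> (forall z, I z -> 0 < D z) ->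
  (forall t, J t -> (A (u t) * derive1 v t - B (u t) * derive1 u t) ^+ 2 =
                    D (u t) * derive1 u t ^+ 2) ->
  I u0 ->
  exists (V : R -> R) (s : bool),
    reparametrized_by J u alpha (fun w => H3 m.+4 c x w (V w)) /\
    (forall w, I w -> V w = V u0 + oriented_integral u0 w
       (fun z => (B z + (-1) ^+ s * Num.sqrt (D z)) / A z)).
Proof.
move=> hI hJ cA cB cD A0 D0 quad Iu0; have [su sv uI _ _] := hlox.
have u'0 t : J t -> derive1 u t != 0.
  by move=> Jt; apply: derive1_u_neq0 (quad _ Jt) => //; exact/lt0r_neq0/A0/uI.
have du t : J t -> derivable u t 1 by exact: su 0%N t.
have dv t : J t -> derivable v t 1 by exact: sv 0%N t.
have [V [s [vV VE]]] := quadratic_slope_integral hI hJ cA cB cD A0 D0 du dv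
  (fun t => smooth_on_continuous1 su) (fun t => smooth_on_continuous1 sv)
  uI u'0 quad Iu0.
exists V, s; split => //; split => //.
- by have [_ iJ _] := hJ; exact: derive1_neq0_inj du u'0.
- by move=> t Jt; rewrite /alpha -vV.
Qed.

End Loxodrome.

(** In both types [A] and [D] are combinations of $x_n^2$ and $x_n'^2$ with constant
    coefficients. *)
Lemma continuous_sqr_comb (R : realType) (a b : R) (f g h : R -> R) (z : R) :
  {for z, continuous f} -> {for z, continuous g} ->
  (forall y, h y = a * (f y * f y) + b * (g y * g y)) ->
  {for z, continuous h}.
Proof.
move=> cf cg hE.
have -> : h = (fun y => a * (f y * f y) + b * (g y * g y)) by exact/funext.
apply: cvgD; apply: cvgM; [exact: cvg_cst| |exact: cvg_cst|].
- by apply: cvgM; exact: cf.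
- by apply: cvgM; exact: cg.
Qed.

(** * The two causal types of meridian *)

Unset Implicit Arguments.

Theorem theorem5p2 (R : realType) (n : nat) (hn : (4 <= n)%N)
  (I : set R) (hI : open_interval I)
  (x : nat -> R -> R) (hx : smooth_profile n x I)
  (eps : R) (heps : eps = 1 \/ eps = -1)
  (hbeta : arc_length_profile n x I eps)
  (c : R) (hc : 0 < c)
  (hS : timelike_surface n c x I)
  (phi0 : R) (hphi0 : 0 < phi0)
  (J : set R) (hJ : open_interval J) (u v : R -> R)
  (hlox : timelike_loxodrome n c x I J u v phi0)
  (u0 : R) (hu0 : I u0) :
  exists V : R -> R,
    reparametrized_by J u (fun t => H3 n c x (u t) (v t))
      (fun w => H3 n c x w (V w)) /\
    ((eps = 1 /\ exists s : bool, forall w, I w ->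
        V w = V u0 + oriented_integral u0 w (slope_i c phi0 (x n) s)) \/
     (eps = -1 /\ exists s : bool, forall w, I w ->
        V w = V u0 + oriented_integral u0 w (slope_ii c phi0 (x n) s))).
Proof.
move: hn x hx hbeta hS hlox; case: n => [|[|[|[|m]]]]// _ x hx hbeta hS hlox.
pose X := x m.+4; pose d := derive1 X.
have sX : smooth_on I X by apply: hx; rewrite //= leqnn.
have cX z : I z -> {for z, continuous X} by exact: smooth_on_continuous.
have cd z : I z -> {for z, continuous d} by exact: smooth_on_continuous1.
have cscale k z : I z -> {for z, continuous (fun y => k * d y)}.
  by move=> /cd cdz; apply: cvgM => //; exact: cvg_cst.
have [_ _ _ tl ang] := hlox.
have sh20 : 0 < sinh (2 * phi0) ^+ 2.
  by rewrite exprn_gt0// sinh_gt0// mulr_gt0.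
have surf z : I z -> 2 * eps * X z ^+ 2 - c ^+ 2 * d z ^+ 2 < 0.
  exact: timelike_surfaceE hx hbeta z hS.
have angle t Jt := conj (mink_H3_u hx hbeta hlox (t := t) Jt)
  (conj (mink_alpha' hx hbeta hlox Jt) (mink_H3_u_alpha' hx hbeta hlox Jt)).
case: heps => epsE; subst eps.
(* Spacelike meridians, formula (i): [A], [B] and [D] are the denominator, the rational part of the
   numerator and the radicand. *)
- have [|||z Iz|z Iz|t Jt|V [s [HV VE]]] :=
    @loxodrome_integral _ _ _ _ _ _ hx hbeta _ _ _ _ hlox
    (fun z => 4 * sinh phi0 ^+ 2 * X z ^+ 2 + 2 * c ^+ 2 * d z ^+ 2)
    (fun z => 2 * c * cosh phi0 ^+ 2 * d z)
    (fun z => sinh (2 * phi0) ^+ 2 * (c ^+ 2 * d z ^+ 2 - 2 * X z ^+ 2))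
    u0 hI hJ _ _ _ _ _ _ hu0.
  + move=> z Iz; apply: (continuous_sqr_comb (a := 4 * sinh phi0 ^+ 2)
      (b := 2 * c ^+ 2) (cX _ Iz) (cd _ Iz)) => y; ring.
  + by move=> z; exact: cscale.
  + move=> z Iz; apply: (continuous_sqr_comb (a := - 2 * sinh (2 * phi0) ^+ 2)
      (b := sinh (2 * phi0) ^+ 2 * c ^+ 2) (cX _ Iz) (cd _ Iz)) => y; ring.
  (* The surface being timelike gives $c^2x_n'^2 > 2x_n^2 \ge 0$, which makes [A] positive, and [D]
     as well. *)
  + have := surf z Iz; have : 0 <= X z ^+ 2 := sqr_ge0 _.
    have : 0 <= sinh phi0 ^+ 2 * X z ^+ 2 by rewrite mulr_ge0 ?sqr_ge0.
    lra.
  + by rewrite mulr_gt0//; have := surf z Iz; lra.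
  + have [hH [ha hHa]] := angle t Jt.
    have := timelike_angle_spacelike hH (tl _ Jt) (ang _ Jt).
    by rewrite ha hHa !mul1r; exact: slope_i_quadratic.
  + by exists V; split => //; left; split => //; exists s.
(* Timelike meridians, formula (ii), with the same reading of [A], [B] and [D]. *)
- have [|||z Iz|z Iz|t Jt|V [s [HV VE]]] :=
    @loxodrome_integral _ _ _ _ _ _ hx hbeta _ _ _ _ hlox
    (fun z => 4 * cosh phi0 ^+ 2 * X z ^+ 2 + 2 * c ^+ 2 * d z ^+ 2)
    (fun z => 2 * c * sinh phi0 ^+ 2 * d z)
    (fun z => sinh (2 * phi0) ^+ 2 * (2 * X z ^+ 2 + c ^+ 2 * d z ^+ 2))
    u0 hI hJ _ _ _ _ _ _ hu0.
  + move=> z Iz; apply: (continuous_sqr_comb (a := 4 * cosh phi0 ^+ 2)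
      (b := 2 * c ^+ 2) (cX _ Iz) (cd _ Iz)) => y; ring.
  + by move=> z; exact: cscale.
  + move=> z Iz; apply: (continuous_sqr_comb (a := 2 * sinh (2 * phi0) ^+ 2)
      (b := sinh (2 * phi0) ^+ 2 * c ^+ 2) (cX _ Iz) (cd _ Iz)) => y; ring.
  (* Here the condition on the surface says $2x_n^2+c^2x_n'^2>0$, and $\cosh^2 = 1+\sinh^2$ bounds
     [A] below by twice this sum. *)
  + have := surf z Iz; rewrite sqr_cosh.
    have : 0 <= sinh phi0 ^+ 2 * X z ^+ 2 by rewrite mulr_ge0 ?sqr_ge0.
    have : 0 <= c ^+ 2 * d z ^+ 2 by rewrite mulr_ge0 ?sqr_ge0.
    lra.
  + by rewrite mulr_gt0//; have := surf z Iz; lra.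
  + have [hH [ha hHa]] := angle t Jt.
    have := timelike_angle_timelike hH (tl _ Jt) (ang _ Jt).
    by rewrite ha hHa !mulN1r; exact: slope_ii_quadratic.
  + by exists V; split => //; right; split => //; exists s.
Qed.
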